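(* As $q\to\infty$, the value functions $V^{(q)}_\infty$ converge to $V^{lim}_\infty$ uniformly on compact subsets of $\mathbb{R}^n$.
   Context: Let $n\ge1$ be an integer, $J_n$ the $n\times n$ Jordan block with eigenvalue $0$ (ones on the superdiagonal, zeros elsewhere) and $e_n$ the last canonical basis vector of $\mathbb{R}^n$. The control system is $\dot x=J_nx+e_nu$. The function $F:\mathbb{R}^n\to\mathbb{R}_{\ge0}$ is continuously differentiable, convex and positive definite ($F(0)=0$, $F(x)>0$ for $x\ne0$), and does not depend on $q$. For $q\in(1,\infty)$, $V^{(q)}_\infty(x_0)=\inf_{u\in L^q(\mathbb{R}_{\ge0},\mathbb{R})}\int_0^\infty\left(\frac{|u(t)|^q}{q}+F(x(t))\right)dt$, and $V^{lim}_\infty(x_0)=\inf_{u\in L^\infty(\mathbb{R}_{\ge0},[-1,1])}\int_0^\infty F(x(t))\,dt$, where in both cases $x(\cdot)$ is the trajectory of the control system with $x(0)=x_0$ and control $u$. *)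

(* Defs.v *)
From HB Require Import structures.
From mathcomp Require Import all_boot all_order all_algebra.
From mathcomp Require Import all_classical all_reals all_analysis.

Set Implicit Arguments.
Unset Strict Implicit.
Unset Printing Implicit Defensive.

Import Order.TTheory GRing.Theory Num.Theory.
Import numFieldNormedType.Exports.

Local Open Scope classical_set_scope.
Local Open Scope ring_scope.

Section Defs.
Variables (R : realType) (n : nat).

Local Notation mu := (@lebesgue_measure R).
Local Notation halfline := (`[0, +oo[%classic : set R).

Definition jordan0 : 'M[R]_n := \matrix_(i, j) (j == i.+1 :> nat)%:R.

Definition e_last : 'cV[R]_n := \col_i (i.+1 == n :> nat)%:R.

Definition velocity (x : 'cV[R]_n) (v : R) : 'cV[R]_n :=
  jordan0 *m x + v *: e_last.

(* Caratheodory solution on the half-line: x is absolutely continuous with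
   x' = velocity x u almost everywhere and x(0) = x0, that is, x is the
   indefinite integral of its velocity.  Values at negative times are
   irrelevant, here and below. *)
Definition trajectory (x0 : 'cV[R]_n) (u : R -> R) (x : R -> 'cV[R]_n) : Prop :=
  forall (t : R) (i : 'I_n), 0 <= t ->
    mu.-integrable `[0, t] (fun s => (velocity (x s) (u s) i 0)%:E) /\
    x t i 0 = x0 i 0 + \int[mu]_(s in `[0, t]) velocity (x s) (u s) i 0.

(* L^q(R_{>=0}, R): the extension by 0 to the whole line is in L^q(R). *)
Definition control_Lq (q : R) (u : R -> R) : Prop :=
  u \_ halfline \in Lfun mu q%:E.

Definition control_Linf1 (u : R -> R) : Prop :=
  u \_ halfline \in Lfun mu +oo%E /\
  {ae mu, forall t, 0 <= t -> u t \in `[-1, 1]}.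

Definition value_q (F : 'cV[R]_n -> R) (q : R) (x0 : 'cV[R]_n) : \bar R :=
  ereal_inf [set c | exists u x, [/\ control_Lq q u, trajectory x0 u x &
    c = (\int[mu]_(t in halfline) (`|u t| `^ q / q + F (x t))%:E)%E]].

Definition value_lim (F : 'cV[R]_n -> R) (x0 : 'cV[R]_n) : \bar R :=
  ereal_inf [set c | exists u x, [/\ control_Linf1 u, trajectory x0 u x &
    c = (\int[mu]_(t in halfline) (F (x t))%:E)%E]].

Definition gradient (F : 'cV[R]_n -> R) (x : 'cV[R]_n) : 'cV[R]_n :=
  \col_i 'd F x (delta_mx i 0).

Definition continuously_differentiable (F : 'cV[R]_n -> R) : Prop :=
  (forall x, differentiable F x) /\ continuous (gradient F).

Definition positive_definite (F : 'cV[R]_n -> R) : Prop :=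
  F 0 = 0 /\ forall x, x != 0 -> 0 < F x.

End Defs.

(* Main.v *)
Require Import Defs.
From HB Require Import structures.
From mathcomp Require Import all_boot all_order all_algebra.
From mathcomp Require Import all_classical all_reals all_analysis.
From mathcomp Require Import measurable_realfun ess_sup_inf ring lra.

Set Implicit Arguments.
Unset Strict Implicit.
Unset Printing Implicit Defensive.

Import Order.TTheory GRing.Theory Num.Theory.
Import numFieldNormedType.Exports.

Local Open Scope classical_set_scope.
Local Open Scope ring_scope.

(* A near-optimal trajectory of either problem reaches, within a time T that is
   uniform over compact sets of initial states, a point of small running cost,
   hence (F is convex and positive definite) a point close to 0.  From there a
   Hermite interpolant steers the system to 0 in unit time with a small control
   and a small cost.  The repaired control is bounded by 1 and vanishes after
   T + 1, so its L^q cost is at most (T + 1) / q: this gives the upper bound on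
   the L^q values.  For the lower bound, a near-optimal u of the L^q problem is
   first truncated to [-1, 1]: Bernoulli's inequality bounds (|u| - 1)^2 by
   (4 / q) * |u|^q / q, so truncation costs little in L^1 on [0, T] and moves the
   trajectory little on [0, T]. *)

(** * Sup norm of column vectors and compactness of closed balls *)

Lemma col_norm_coord (R : realType) (n : nat) (x : 'cV[R]_n) i : `|x i 0| <= `|x|.
Proof.
by rewrite [leRHS]/Num.norm /= mx_normrE; apply/bigmax_geP; right => /=; exists (i, 0).
Qed.

Lemma col_norm_le (R : realType) (n : nat) (x : 'cV[R]_n) (B : R) :
  0 <= B -> (forall i, `|x i 0| <= B) -> `|x| <= B.
Proof.
move=> B0 xB; rewrite [leLHS]/Num.norm /= mx_normrE; apply/bigmax_leP; split => //.
by move=> [i j] _ /=; rewrite ord1.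
Qed.

Lemma trmx_continuous (R : realType) (m n : nat) : continuous (@trmx R m n).
Proof.
move=> x A /nbhs_ballP[e /= e0 eA]; apply/nbhs_ballP; exists e => //= y [_ xye].
by apply: eA; split=> // i j; rewrite !mxE.
Qed.

(** Heine-Borel is applied to row vectors, and transposition, being continuous, carries compactness
    over to columns. *)
Lemma closed_ball_col_compact (R : realType) (n : nat) (B : R) :
  compact [set x : 'cV[R]_n | `|x| <= B].
Proof.
have -> : [set x : 'cV[R]_n | `|x| <= B] = trmx @` [set v : 'rV[R]_n | `|v^T| <= B].
  apply/seteqP; split=> [x xB|_ [v vB <-]//].
  by exists x^T; rewrite /= trmxK.
apply: continuous_compact; first exact/continuous_subspaceT/trmx_continuous.
apply: bounded_closed_compact.
  exists B; split; first exact: num_real.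
  move=> M BM v /= vB; apply: le_trans (ltW BM); apply: le_trans vB.
  rewrite [leLHS]/Num.norm /= mx_normrE; apply/bigmax_leP; split => // -[i j] _ /=.
  by have := col_norm_coord v^T j; rewrite mxE ord1.
apply: (@closed_comp _ _ _ [set x : R | x <= B]); last exact: closed_le.
move=> v _; apply: continuous_comp; first exact: trmx_continuous.
exact: norm_continuous.
Qed.

(** * Convex positive definite functions: local Lipschitz bounds and coercivity *)

Section convex_cost.
Variables (R : realType) (n : nat) (F : 'cV[R]_n -> R).
Hypothesis F_cont : continuous F.
Hypothesis F_convex : convex_function setT F.
Hypothesis F_posdef : positive_definite F.

Lemma positive_definite_ge0 x : 0 <= F x.
Proof.
have [->|x0] := eqVneq x 0; first by rewrite F_posdef.1.
exact/ltW/F_posdef.2.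
Qed.

Lemma convex_combination_le (t : R) (x y : 'cV[R]_n) : 0 <= t <= 1 ->
  F (t *: x + (1 - t) *: y) <= t * F x + (1 - t) * F y.
Proof.
move=> t01.
have [t0 t1] : 0 <= t /\ t <= 1 by move/andP: t01.
have /(_ x y) := F_convex (Itv01 t0 t1).
by apply; rewrite inE.
Qed.

Lemma bounded_on_balls (B : R) : exists M, 0 < M /\ forall x, `|x| <= B -> F x <= M.
Proof.
have [B0|B0] := ltP B 0.
  by exists 1; split => // x xB; have := le_lt_trans xB B0; rewrite normr_lt0.
have := @compact_EVT_max _ _ F _ _ (@closed_ball_col_compact R n B) _.
case; [by exists 0; rewrite /= normr0|exact: continuous_subspaceT|].
move=> c _ cmax; exists (F c + 1); split; first by rewrite ltr_wpDl// positive_definite_ge0.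
move=> x xB; apply: (@le_trans _ _ (F c)); last by rewrite lerDl.
by apply: cmax; rewrite inE.
Qed.

(* Writing y = (1 - d) x + d z with d = |y - x| puts z at distance 1 from x, so
   the slope of F is controlled by its values on a slightly larger ball. *)
Lemma convex_locally_lipschitz (B : R) : exists L, 0 < L /\ forall x y, `|x| <= B ->
  `|y - x| <= 1 -> F y <= F x + `|y - x| * L.
Proof.
have [M [M0 FM]] := bounded_on_balls (B + 1).
exists M; split => // x y xB yx1; set d := `|y - x| in yx1 *.
have [d0|d0] := eqVneq d 0.
  by rewrite d0 mul0r addr0; move/eqP: d0; rewrite normr_eq0 subr_eq0 => /eqP ->.
have dge0 : 0 <= d by exact: normr_ge0.
pose z := x + d^-1 *: (y - x).
have zB : `|z| <= B + 1.
  apply: le_trans (ler_normD _ _) _; apply: lerD => //.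
  by rewrite normrZ normfV ger0_norm ?normr_ge0// mulVf.
have yE : y = d *: z + (1 - d) *: x.
  by apply/matrixP => i j; rewrite !mxE; field.
have := @convex_combination_le d z x; rewrite dge0 yx1 -yE => /(_ isT) /le_trans; apply.
have Fz : d * F z <= d * M by rewrite ler_wpM2l// FM.
have dFx : 0 <= d * F x by rewrite mulr_ge0// positive_definite_ge0.
lra.
Qed.

(** On the sphere of radius [r] the function has a positive minimum. Convexity on the segment from 0
    to a point [x] outside the ball gives [F ((r / |x|) x) <= (r / |x|) F x <= F x], so the minimum
    also bounds [F x] from below, and half of it can serve as [m]. *)
Lemma convex_posdef_coercive (r : R) : 0 < r -> exists m, 0 < m /\
  forall x, F x <= m -> `|x| <= r.
Proof.
move=> r0.
(* The sphere is empty when [n = 0]. In that case no vector has norm above [r], since rescaling it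
   would give a point of the sphere. *)
have [[x1 x1r]|H] := pselect (exists x : 'cV[R]_n, `|x| = r); last first.
  exists 1; split => // x _; rewrite leNgt; apply/negP => rx; apply: H.
  have x0 : 0 < `|x| by apply: lt_trans rx.
  exists ((r / `|x|) *: x); rewrite normrZ normrM normfV normr_id ger0_norm ?ltW//.
  by rewrite divfK// gt_eqF.
have cS : compact [set x : 'cV[R]_n | `|x| = r].
  rewrite [X in compact X](_ : _ = [set x : 'cV[R]_n | `|x| <= r] `&`
      [set x : 'cV[R]_n | `|x| = r]); last first.
    by apply/seteqP; split=> x /= => [xr|[]//]; rewrite xr.
  apply: compact_closedI; first exact: closed_ball_col_compact.
  apply: (@closed_comp _ _ _ [set x : R | x = r]); last exact: closed_eq.
  by move=> v _; exact: norm_continuous.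
have := @compact_EVT_min _ _ F _ _ cS _.
case; [by exists x1|exact: continuous_subspaceT|].
move=> c; rewrite inE /= => cr cmin.
have Fc : 0 < F c by apply: F_posdef.2; rewrite -normr_gt0 cr.
exists (F c / 2); split; first by rewrite divr_gt0.
move=> x xc; rewrite leNgt; apply/negP => rx.
have x0 : 0 < `|x| by apply: lt_trans rx.
have t01 : 0 <= r / `|x| <= 1.
  by apply/andP; split; [rewrite divr_ge0// ltW|rewrite ler_pdivrMr// mul1r ltW].
have := @convex_combination_le (r / `|x|) x 0 t01.
rewrite scaler0 addr0 F_posdef.1 mulr0 addr0 => H.
have rxE : `|(r / `|x|) *: x| = r.
  by rewrite normrZ normrM normfV normr_id (gtr0_norm r0) divfK ?gt_eqF.
have Fcx : F c <= F ((r / `|x|) *: x) by apply: cmin; rewrite inE.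
have tF : r / `|x| * F x <= F x by rewrite ler_piMl ?positive_definite_ge0//; case/andP: t01.
lra.
Qed.

End convex_cost.

(** Integrability and continuity along a trajectory are available on bounded intervals only; this
    exhaustion extends measurability to the half-line. *)
Lemma halfline_bigcup (R : realType) : `[0, +oo[%classic = \bigcup_k `[0, k%:R]%classic :> set R.
Proof.
apply/seteqP; split=> t /=; rewrite in_itv/= ?andbT.
  move=> t0; exists (Num.truncn t).+1 => //=.
  by rewrite in_itv/= t0 ltW// truncnS_gt.
by move=> [k _] /=; rewrite in_itv/= => /andP[].
Qed.

(** * Integrator chains: equivalence with trajectories, bounds, existence, gluing *)

Section chains.
Variables (R : realType) (n : nat).
Local Notation mu := (@lebesgue_measure R).
Implicit Types (y z : nat -> R -> R) (u : R -> R).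

(* The system is an integrator chain: y 0, ..., y n.-1 are the coordinates of
   the state and y n is the control. *)
Definition chain (x0 : 'cV[R]_n) y := forall (i : 'I_n) (t : R), 0 <= t ->
  mu.-integrable `[0, t] (EFin \o y i.+1) /\
  y i t = x0 i 0 + \int[mu]_(s in `[0, t]) y i.+1 s.

(** State and control are packed into one sequence so that the last state equation has the same form
    as the others; every index from [n] on carries the control. *)
Definition coord_chain u (x : R -> 'cV[R]_n) (k : nat) (t : R) : R :=
  if insub k is Some i then x t i 0 else u t.

Definition chain_state y (t : R) : 'cV[R]_n := \col_i y i t.

(** The Jordan block shifts the coordinates by one and has a zero last row, which is exactly where
    [e_last] lets the control in. *)
Lemma velocityE (x : 'cV[R]_n) (v : R) (i : 'I_n) :
  velocity x v i 0 = if insub i.+1 is Some j then x j 0 else v.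
Proof.
rewrite !mxE; case: insubP => [j ji jE|]; last first.
  rewrite -leqNgt => ni; have iS : i.+1 = n by apply/eqP; rewrite eqn_leq ni ltn_ord.
  rewrite iS eqxx mulr1 big1 ?add0r// => j _; rewrite mxE iS.
  by rewrite ltn_eqF ?mul0r.
rewrite (_ : _ == _ :> nat = false) ?mulr0 ?addr0; last by rewrite ltn_eqF.
rewrite (bigD1 j)//= mxE jE eqxx mul1r big1 ?addr0// => k kj.
by rewrite mxE -jE val_eqE (negbTE kj) mul0r.
Qed.

Lemma coord_chain_lt u (x : R -> 'cV[R]_n) (i : 'I_n) t : coord_chain u x i t = x t i 0.
Proof. by rewrite /coord_chain valK. Qed.

Lemma coord_chain_last u (x : R -> 'cV[R]_n) : coord_chain u x n = u.
Proof. by apply/funext => t; rewrite /coord_chain insubN// ltnn. Qed.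

Lemma coord_chainS u (x : R -> 'cV[R]_n) (i : 'I_n) t :
  coord_chain u x i.+1 t = velocity (x t) (u t) i 0.
Proof. by rewrite velocityE. Qed.

Lemma chain_of_trajectory (x0 : 'cV[R]_n) u x : trajectory x0 u x -> chain x0 (coord_chain u x).
Proof.
move=> xP i t t0; have [ix xE] := xP t i t0.
have vE : (fun s => velocity (x s) (u s) i 0) = coord_chain u x i.+1.
  by apply/funext => s; rewrite coord_chainS.
rewrite coord_chain_lt xE.
by move: ix; rewrite -[X in _.-integrable _ X -> _]/(EFin \o (fun s =>
  velocity (x s) (u s) i 0)) vE.
Qed.

Lemma trajectory_of_chain (x0 : 'cV[R]_n) y : chain x0 y -> trajectory x0 (y n) (chain_state y).
Proof.
move=> yP t i t0; have [iy yE] := yP i t t0.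
have vE : (fun s => velocity (chain_state y s) (y n s) i 0) = y i.+1.
  apply/funext => s; rewrite velocityE; case: insubP => [j _ jE|]; first by rewrite mxE jE.
  rewrite -leqNgt => ni; congr (y _ s).
  by apply/esym/eqP; rewrite eqn_leq ni ltn_ord.
rewrite mxE yE -[X in _.-integrable _ X]/(EFin \o (fun s =>
  velocity (chain_state y s) (y n s) i 0)).
by rewrite vE.
Qed.

Lemma chain_state_coord u (x : R -> 'cV[R]_n) : chain_state (coord_chain u x) = x.
Proof. by apply/funext => t; apply/colP => i; rewrite mxE coord_chain_lt. Qed.

Lemma chain_integrable (x0 : 'cV[R]_n) y (k : nat) t : chain x0 y -> 0 <= t -> (0 < k <= n)%N ->
  mu.-integrable `[0, t] (EFin \o y k).
Proof.
case: k => // k yP t0 kn; exact: (yP (Ordinal kn) t t0).1.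
Qed.

Lemma chain_primitive (x0 : 'cV[R]_n) y (i : 'I_n) t : chain x0 y -> 0 <= t ->
  y i t = x0 i 0 + \int[mu]_(s in `[0, t]) y i.+1 s.
Proof. by move=> yP t0; exact: (yP i t t0).2. Qed.

Lemma chain_initial (x0 : 'cV[R]_n) y (i : 'I_n) : chain x0 y -> y i 0 = x0 i 0.
Proof.
by move=> yP; rewrite (chain_primitive i yP)// set_itv1 Rintegral_set1 addr0.
Qed.

Lemma primitive_within_continuous (c T : R) (f : R -> R) : 0 <= T ->
  mu.-integrable `[0, T] (EFin \o f) ->
  {within `[0, T], continuous (fun t => c + \int[mu]_(s in `[0, t]) f s)}.
Proof.
move=> T0 fi; have fc := parameterized_integral_continuous T0 fi.
by move=> t; apply: cvgD; [exact: cvg_cst|exact: fc].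
Qed.

Lemma chain_within_continuous (x0 : 'cV[R]_n) y (i : 'I_n) (T : R) : chain x0 y -> 0 <= T ->
  {within `[0, T], continuous (y i)}.
Proof.
move=> yP T0; have := @primitive_within_continuous (x0 i 0) T _ T0 (yP i T T0).1.
apply: subspace_eq_continuous => t; rewrite inE /= in_itv/= => /andP[t0 _].
by rewrite [RHS](chain_primitive i yP t0).
Qed.

(** Starting from the control and going down in the index, each integration over a time at most [T]
    followed by adding an initial value at most [B] multiplies the bound by at most [1 + T]. *)
Lemma chain_bound (x0 : 'cV[R]_n) y (B T : R) : chain x0 y -> (0 < n)%N -> 0 <= T ->
  (forall i, `|x0 i 0| <= B) -> forall (i : 'I_n) t, 0 <= t <= T ->
  `|y i t| <= (1 + T) ^+ n * (B + \int[mu]_(s in `[0, T]) `|y n s|).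
Proof.
move=> yP n0 T0 x0B; set I := \int[mu]_(s in _) _.
have B0 : 0 <= B by apply: le_trans (x0B (Ordinal n0)).
have I0 : 0 <= I by apply: Rintegral_ge0.
have T1 : 1 <= 1 + T by rewrite lerDl.
have BI : 0 <= B + I by rewrite addr_ge0.
(* [k.+1] counts the integrations that separate the coordinate from the control, so the induction
   runs from the last coordinate to the first. *)
suff H k : (k < n)%N -> forall i : 'I_n, (i = n - k.+1 :> nat)%N -> forall t, 0 <= t <= T ->
    `|y i t| <= (1 + T) ^+ k.+1 * (B + I).
  move=> i t tT; have ni : (n - i.+1 < n)%N by rewrite ltn_subrL n0.
  have iE : (i = n - (n - i.+1).+1 :> nat)%N by rewrite -subSn// subSS subKn// ltnW.
  apply: le_trans (H _ ni i iE t tT) _; rewrite ler_wpM2r// ler_weXn2l//.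
elim: k => [|k IH] kn i iE t /andP[t0 tT].
  rewrite (chain_primitive i yP t0) expr1; have iS : i.+1 = n by rewrite iE subn1 prednK.
  have iT : mu.-integrable `[0, T] (EFin \o y n) by rewrite -iS; exact: (yP i T T0).1.
  have it : mu.-integrable `[0, t] (EFin \o y n) by rewrite -iS; exact: (yP i t t0).1.
  apply: (@le_trans _ _ (B + I)); last by rewrite ler_peMl.
  apply: le_trans (ler_normD _ _) _; apply: lerD; first exact: x0B.
  rewrite iS; apply: le_trans (le_normr_Rintegral _ it) _ => //.
  have itvE : `[0, T]%classic = `[0, t]%classic `|` `]t, T]%classic :> set R.
    by rewrite -itv_bndbnd_setU// bnd_simp.
  have inT := integrable_norm iT.
  rewrite /I itvE Rintegral_setU//=.
  - by rewrite lerDl Rintegral_ge0.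
  - by rewrite -itvE.
  - apply/disj_setPS => s [] /=; rewrite !in_itv/= => /andP[_ st] /andP[ts _].
    by move: (lt_le_trans ts st); rewrite ltxx.
have iSn : (i.+1 < n)%N.
  by rewrite iE -subSn// subSS ltn_subrL n0.
have yS s : 0 <= s <= T -> `|y i.+1 s| <= (1 + T) ^+ k.+1 * (B + I).
  by apply: (IH (ltnW kn) (Ordinal iSn)) => /=; rewrite iE -subSn.
set M := (1 + T) ^+ k.+1 * (B + I) in yS.
have it := (yP i t t0).1.
rewrite (chain_primitive i yP t0).
have M0 : B + I <= M by rewrite ler_peMl// exprn_ege1.
(* Since [B <= B + I <= M], the sum [B + T * M] is at most [(1 + T) * M]. *)
apply: (@le_trans _ _ (B + T * M)); last first.
  rewrite exprS -mulrA -/M mulrDl mul1r; lra.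
apply: le_trans (ler_normD _ _) _; apply: lerD; first exact: x0B.
apply: le_trans (le_normr_Rintegral _ it) _ => //.
apply: (@le_trans _ _ (\int[mu]_(s in `[0, t]) M)).
  apply: le_Rintegral => //; first exact: integrable_norm.
  - apply: continuous_compact_integrable; first exact: segment_compact.
    exact/continuous_subspaceT/cst_continuous.
  - move=> s /=; rewrite in_itv/= => /andP[s0 st]; apply: yS.
    by rewrite s0 (le_trans st).
rewrite Rintegral_cst//= lebesgue_measure_itv/=.
case: ifPn => [_|_]; last by rewrite mulr0 mulr_ge0// (le_trans BI).
by rewrite /= subr0 mulrC ler_wpM2r// (le_trans BI).
Qed.

Lemma chain_exists (x0 : 'cV[R]_n) u : (forall t, 0 <= t -> mu.-integrable `[0, t] (EFin \o u)) ->
  exists y, chain x0 y /\ y n = u.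
Proof.
move=> ui.
pose a k : R := if insub k is Some i then x0 i 0 else 0.
(* The recursion starts at the control: for [k <= n], [Y k] is the component of index [n - k],
   obtained by [k] successive primitives with the prescribed initial values. *)
pose Y := fix Y (k : nat) : R -> R := if k is k'.+1 then
  fun t => a (n - k)%N + \int[mu]_(s in `[0, t]) Y k' s else u.
have Yi k t : 0 <= t -> mu.-integrable `[0, t] (EFin \o Y k).
  elim: k t => [|k IH] t t0; first exact: ui.
  apply: continuous_compact_integrable; first exact: segment_compact.
  exact/primitive_within_continuous/IH.
exists (fun k => Y (n - k)%N); split; last by rewrite subnn.
move=> i t t0; split; first exact: Yi.
by rewrite -(subSS i) subSn//= -subSn// subSS subKn 1?ltnW// /a valK.
Qed.

(** For two chains with the same initial state the difference starts at 0, and [chain_bound] then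
    turns L^1 closeness of the controls into uniform closeness of the states. *)
Lemma chainB (x0 : 'cV[R]_n) x0' y y' : chain x0 y -> chain x0' y' ->
  chain (x0 - x0') (fun k t => y k t - y' k t).
Proof.
move=> yP yP' i t t0; have [iy yE] := yP i t t0; have [iy' yE'] := yP' i t t0.
split; first by apply: eq_integrable (integrableB _ iy iy').
by rewrite RintegralB// yE yE' !mxE opprD addrACA.
Qed.

Lemma integrable_setU_itv (a s t : R) (f g : R -> R) : a <= s <= t ->
  mu.-integrable `[a, s] (EFin \o f) -> mu.-integrable `[s, t] (EFin \o g) ->
  mu.-integrable `[a, t] (EFin \o (fun r => if r < s then f r else g r)) /\
  \int[mu]_(r in `[a, t]) (if r < s then f r else g r) =
  \int[mu]_(r in `[a, s]) f r + \int[mu]_(r in `[s, t]) g r.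
Proof.
move=> /andP[as_ st] fi gi; set h : R -> R := fun r => if r < s then _ else _.
have itvE : `[a, t]%classic = `[a, s[%classic `|` `[s, t]%classic :> set R.
  by rewrite -itv_bndbnd_setU// bnd_simp.
have disj : [disjoint `[a, s[%classic & `[s, t]%classic].
  apply/disj_setPS => r [] /=; rewrite !in_itv/= => /andP[_ rs] /andP[sr _].
  by move: (lt_le_trans rs sr); rewrite ltxx.
have fi' : mu.-integrable `[a, s[ (EFin \o f).
  by apply: integrableS fi => //; apply: subset_itvl; rewrite bnd_simp.
have fh : {in `[a, s[%classic, f =1 h}.
  by move=> r; rewrite inE/= in_itv/= => /andP[_ rs]; rewrite /h rs.
have gh : {in `[s, t]%classic, g =1 h}.
  by move=> r; rewrite inE/= in_itv/= => /andP[sr _]; rewrite /h ltNge sr.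
have hi1 : mu.-integrable `[a, s[ (EFin \o h).
  by apply: eq_integrable fi' => // r rs /=; rewrite fh.
have hi2 : mu.-integrable `[s, t] (EFin \o h).
  by apply: eq_integrable gi => // r rs /=; rewrite gh.
have hi : mu.-integrable `[a, t] (EFin \o h).
  rewrite itvE; case/integrableP: hi1 => m1 i1; case/integrableP: hi2 => m2 i2.
  apply/integrableP; split; first by apply/measurable_funU.
  rewrite ge0_integral_setU//=; first by rewrite lte_add_pinfty.
  apply/measurable_EFinP; apply: measurableT_comp => //.
  by apply/measurable_EFinP/measurable_funU.
split => //.
rewrite itvE Rintegral_setU//; last by rewrite -itvE.
congr (_ + _); last exact/esym/eq_Rintegral.
(* At [s] the glued function already takes the value of [g], so the first piece lives on the
   half-open interval; the endpoint does not change the integral. *)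
rewrite -Rintegral_itv_bndo_bndc//; exact/esym/eq_Rintegral.
Qed.

Definition glue (s : R) y z (k : nat) (t : R) := if t < s then y k t else z k t.

Lemma chain_glue (x0 : 'cV[R]_n) y z (s : R) : 0 <= s -> chain x0 y ->
  (forall (i : 'I_n) t, s <= t -> mu.-integrable `[s, t] (EFin \o z i.+1) /\
    z i t = y i s + \int[mu]_(r in `[s, t]) z i.+1 r) ->
  chain x0 (glue s y z).
Proof.
move=> s0 yP zP i t t0; rewrite /glue; case: ifPn => [ts|].
  have [iy yE] := yP i t t0.
  have yh : {in `[0, t]%classic, y i.+1 =1 glue s y z i.+1}.
    move=> r; rewrite inE/= in_itv/= => /andP[_ rt].
    by rewrite /glue (le_lt_trans rt ts).
  split; first by apply: eq_integrable iy => // r rt; congr (_%:E); exact: yh.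
  by rewrite yE; congr (_ + _); exact: eq_Rintegral.
rewrite -leNgt => st; have [zi zE] := zP i t st; have [yi yE] := yP i s s0.
have := @integrable_setU_itv 0 s t _ _ _ yi zi.
rewrite s0 st => /(_ isT)[hi hE]; split=> //.
by rewrite hE zE yE addrA.
Qed.

Lemma col_continuous (T : topologicalType) (f : T -> 'cV[R]_n) :
  (forall i, continuous (fun t => f t i 0)) -> continuous f.
Proof.
move=> fc t; apply/cvgrPdist_lt => e e0.
have : \forall r \near nbhs t, forall i, `|f t i 0 - f r i 0| < e.
  by apply: filter_forall => i; have /cvgrPdist_lt := fc i t; exact.
apply: filterS => r fr.
rewrite [X in X < _]/Num.norm /= mx_normrE; apply/bigmax_ltP; split => // -[i j] _ /=.
by rewrite ord1 !mxE.
Qed.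

Lemma chain_state_within_continuous (x0 : 'cV[R]_n) y (T : R) : chain x0 y -> 0 <= T ->
  {within `[0, T], continuous (chain_state y)}.
Proof.
move=> yP T0; apply: col_continuous => i.
rewrite (_ : (fun t => _) = y i); first exact: (@chain_within_continuous x0).
by apply/funext => t; rewrite mxE.
Qed.

Lemma measurable_fun_chain_cost (F : 'cV[R]_n -> R) x0 y : continuous F -> chain x0 y ->
  measurable_fun (`[0, +oo[%classic : set R) (F \o chain_state y).
Proof.
move=> Fc yP.
rewrite halfline_bigcup; apply/measurable_fun_bigcup => // k.
apply: subspace_continuous_measurable_fun => //.
have cy := @chain_state_within_continuous x0 y k%:R yP (ler0n _ _).
by move=> t; apply: (cvg_comp _ _ (cy t)); exact: Fc.
Qed.

End chains.

(** * Steering to the origin by Hermite interpolation *)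

Section steering.
Variable R : realType.
Local Notation mu := (@lebesgue_measure R).

Lemma dvdp_exp_deriv (m : nat) (a : R) (p : {poly R}) :
  ('X - a%:P) ^+ m.+1 %| p -> ('X - a%:P) ^+ m %| p^`().
Proof.
move=> /dvdpP[q ->]; rewrite derivM deriv_exp /= dvdp_add//.
  by rewrite exprS mulrA dvdp_mull// dvdpp.
rewrite -mulr_natl mulrCA dvdp_mull// dvdp_mull// -[X in _ %| X]mulr1.
by rewrite derivXsubC mul1r mulr1 dvdpp.
Qed.

Lemma derivn_at_multiple_root (m j : nat) (a : R) (p : {poly R}) :
  (j < m)%N -> ('X - a%:P) ^+ m %| p -> p^`(j).[a] = 0.
Proof.
elim: j m p => [|j IH] [|m] p // jm pm.
  move: pm => /dvdpP[q ->].
  by rewrite derivn0 exprS !hornerM hornerXsubC subrr mul0r mulr0.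
by rewrite derivSn; apply: (IH m) => //; exact: dvdp_exp_deriv.
Qed.

(** A Bezout relation between [X^n] and [(X - 1)^n] gives [phi] congruent to 1 modulo the first and
    to 0 modulo the second. Multiplying [X^i / i!] by [phi] therefore keeps its derivatives of order
    below [n] at 0 and kills those at 1. *)
Lemma hermite_exists (n : nat) : exists h : nat -> {poly R}, forall i j : nat,
  (i < n)%N -> (j < n)%N -> (h i)^`(j).[0] = (i == j)%:R /\ (h i)^`(j).[1] = 0.
Proof.
have : coprimep ('X^n : {poly R}) (('X - 1%:P) ^+ n).
  apply/coprimep_expl/coprimep_expr; rewrite coprimep_XsubC rootE hornerX.
  exact: oner_neq0.
move=> /Bezout_eq1_coprimepP[[a b] /= ab1].
pose phi := b * ('X - 1%:P) ^+ n.
exists (fun i => (i`!%:R)^-1 *: 'X^i * phi) => i j ilt jlt; split; last first.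
  by apply: (@derivn_at_multiple_root n) => //; rewrite mulrA dvdp_mull// dvdpp.
have -> : phi = 1 - a * 'X^n by rewrite -ab1 [RHS]addrC addKr.
rewrite mulrBr mulr1 derivnB hornerD hornerN [X in _ - X]
  (@derivn_at_multiple_root n) ?subr0//.
  rewrite derivnZ derivnXn hornerZ hornerMn hornerXn.
  have [->|ij] := eqVneq i j.
    by rewrite subnn expr0 ffactnn mulVf// pnatr_eq0 -lt0n fact_gt0.
  have [ji|ij'] := ltnP j i.
    by rewrite expr0n subn_eq0 leqNgt ji mul0rn mulr0.
  by rewrite ffact_small ?mulr0n ?mulr0// ltn_neqAle ij.
by rewrite mulrA dvdp_mull// dvdpp.
Qed.

Definition coef_norm (p : {poly R}) : R := \sum_(k < size p) `|p`_k|.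

Lemma horner_unit_itv_bound (p : {poly R}) (r : R) : 0 <= r <= 1 ->
  `|p.[r]| <= coef_norm p.
Proof.
move=> /andP[r0 r1]; rewrite horner_coef; apply: le_trans (ler_norm_sum _ _ _) _.
apply: ler_sum => k _; rewrite normrM normrX (ger0_norm r0).
by rewrite ler_piMr// exprn_ile1.
Qed.

Lemma Rintegral_deriv_poly (p : {poly R}) (s t : R) : s <= t ->
  \int[mu]_(r in `[s, t]) (p^`()).[r] = p.[t] - p.[s].
Proof.
rewrite le_eqVlt => /predU1P[<-|st].
  by rewrite set_itv1 Rintegral_set1 subrr.
rewrite /Rintegral (@continuous_FTC2 _ _ (horner p))//.
- exact/continuous_subspaceT/continuous_horner.
- split; first by move=> r _; exact: derivable_horner.
  + exact/cvg_at_right_filter/continuous_horner.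
  + exact/cvg_at_left_filter/continuous_horner.
- by move=> r _; rewrite derivE.
Qed.

Lemma derivn_comp_affine (p : {poly R}) (c s : R) (j : nat) :
  (p \Po (c *: ('X - s%:P)))^`(j) = c ^+ j *: (p^`(j) \Po (c *: ('X - s%:P))).
Proof.
elim: j => [|j IH]; first by rewrite expr0 scale1r.
rewrite derivnS IH derivZ deriv_comp derivZ derivXsubC -derivnS.
by rewrite -scalerAr mulr1 scalerA exprSr.
Qed.

(* Hermite interpolation of the jets of the first coordinate at both ends.  In
   the rescaled time (t - s) / T the state component of index i has size T ^ i,
   while n derivatives of the interpolant gain T ^ - n: the control is O(1 / T). *)
Lemma steering (n : nat) : exists C : R, 0 < C /\
  forall (a : 'cV[R]_n) (s T : R), 1 <= T -> exists z : nat -> R -> R,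
  [/\ forall (i : 'I_n) t, s <= t -> mu.-integrable `[s, t] (EFin \o z i.+1) /\
        z i t = a i 0 + \int[mu]_(r in `[s, t]) z i.+1 r,
      forall i : 'I_n, z i (s + T) = 0,
      forall (i : 'I_n) t, s <= t <= s + T -> `|z i t| <= C * T ^+ n * `|a| &
      forall t, s <= t <= s + T -> `|z n t| <= C * `|a| / T].
Proof.
have [h hP] := hermite_exists n.
(* One constant dominates all derivatives up to order [n] of all basis polynomials on the unit
   interval; the added 1 gives [1 <= C] even for an empty sum. *)
pose C := 1 + \sum_(i < n) \sum_(j < n.+1) coef_norm (h i)^`(j).
have cn0 p : 0 <= coef_norm p by apply: sumr_ge0.
have C1 : 1 <= C by rewrite lerDl; apply: sumr_ge0 => i _; apply: sumr_ge0.
exists C; split; first exact: lt_le_trans C1.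
move=> a s T T1; have T0 : 0 < T by apply: lt_le_trans T1.
pose q i : {poly R} := h i \Po (T^-1 *: ('X - s%:P)).
(* The factor [T ^+ i] cancels the [T ^- i] that the [i]-th derivative produces in the rescaled
   time. *)
pose P : {poly R} := \sum_(i < n) (a i 0 * T ^+ i) *: q i.
have Pj j t : P^`(j).[t] =
    \sum_(i < n) a i 0 * T ^+ i * (T^-1 ^+ j * (h i)^`(j).[(t - s) / T]).
  rewrite /P linear_sum horner_sum; apply: eq_bigr => i _ /=.
  rewrite derivnZ hornerZ derivn_comp_affine hornerZ horner_comp.
  by rewrite !hornerE mulrC [T^-1 * _]mulrC mulrC.
(* Each summand has size at most [T ^+ i * T ^- j], and [i <= n.-1] with [1 <= T]. For [j = n] a
   single factor [1 / T] remains. *)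
have Pbound j t : (j <= n)%N -> s <= t <= s + T ->
    `|P^`(j).[t]| <= C * T ^+ n.-1 * T^-1 ^+ j * `|a|.
  move=> jn /andP[st tsT]; rewrite Pj.
  have r01 : 0 <= (t - s) / T <= 1.
    apply/andP; split; first by rewrite divr_ge0 ?subr_ge0// ltW.
    by rewrite ler_pdivrMr// mul1r lerBlDl.
  apply: (@le_trans _ _ (\sum_(i < n) (\sum_(j < n.+1) coef_norm (h i)^`(j)) *
      (T ^+ n.-1 * T^-1 ^+ j * `|a|))); last first.
    rewrite -mulr_suml -!mulrA ler_wpM2r//; last by rewrite lerDr.
    by rewrite !mulr_ge0// ?exprn_ge0// ?invr_ge0 ltW.
  apply: le_trans (ler_norm_sum _ _ _) _; apply: ler_sum => i _.
  rewrite !normrM !normrX normfV (gtr0_norm T0).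
  rewrite [X in X <= _](_ : _ = `|(h i)^`(j).[(t - s) / T]| *
     (T ^+ i * T^-1 ^+ j * `|a i 0|)); last by ring.
  have Tj0 : 0 <= T^-1 ^+ j by rewrite exprn_ge0// invr_ge0 ltW.
  apply: ler_pM => //.
  - by rewrite !mulr_ge0// exprn_ge0// ltW.
  - apply: le_trans (horner_unit_itv_bound _ r01) _.
    rewrite (bigD1 (Ordinal (jn : (j < n.+1)%N)))//= lerDl.
    by apply: sumr_ge0.
  - apply: ler_pM => //; [by rewrite mulr_ge0// exprn_ge0// ltW| |exact: col_norm_coord].
    rewrite ler_wpM2r// ler_weXn2l//.
    by rewrite -ltnS prednK// (leq_ltn_trans _ (ltn_ord i)).
(* The chain consists of the successive derivatives of the interpolant, and its [n]-th derivative is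
   the control. *)
exists (fun j t => P^`(j).[t]); split.
- move=> i t st; split.
    apply: continuous_compact_integrable; first exact: segment_compact.
    exact/continuous_subspaceT/continuous_horner.
  rewrite derivnS Rintegral_deriv_poly// [in X in _ + (_ - X)]Pj subrr mul0r.
  rewrite (bigD1 i)//= (hP i i _ _).1// eqxx mulr1 big1 ?addr0; last first.
    by move=> k ki; rewrite (hP k i _ _).1// val_eqE (negbTE ki) !mulr0.
  rewrite -mulrA -exprMn mulfV ?gt_eqF// expr1n mulr1.
  by rewrite addrC subrK.
- move=> i; rewrite Pj big1// => k _.
  by rewrite addrAC subrr add0r mulfV ?gt_eqF// (hP k i _ _).2// !mulr0.
- move=> i t tI; apply: le_trans (Pbound _ _ (ltnW (ltn_ord i)) tI) _.
  rewrite ler_wpM2r// -mulrA ler_wpM2l//; first exact: le_trans C1.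
  rewrite -[leRHS]mulr1; apply: ler_pM => //.
  + by rewrite exprn_ge0// ltW.
  + by rewrite exprn_ge0// invr_ge0 ltW.
  + by rewrite ler_weXn2l// leq_pred.
  + by rewrite exprn_ile1// ?invr_ge0 ?invf_le1// ltW.
- move=> t tI; have [n0|n0] := posnP n.
    rewrite /P; clear -n0 C1 T0; subst n; rewrite big_ord0 derivn0 horner0 normr0.
    by rewrite divr_ge0 ?mulr_ge0// ltW// (lt_le_trans _ C1).
  apply: le_trans (Pbound _ _ (leqnn n) tI) _.
  rewrite -{2}(prednK n0) exprSr mulrA -[_ * T ^+ n.-1 * _]mulrA -exprMn mulfV ?gt_eqF//.
  by rewrite expr1n mulr1 mulrAC.
Qed.

End steering.

(** * Continuing a chain so that it comes to rest at the origin *)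

Section extension.
Variables (R : realType) (n : nat).
Local Notation mu := (@lebesgue_measure R).

(** Three pieces are glued: [y] up to [s], the Hermite arc on [[s, s + T]], then the zero chain.
    They fit because the arc starts at the state of [y] at [s] and ends at 0. *)
Lemma chain_steer : exists C : R, 0 < C /\
  forall (x0 : 'cV[R]_n) (y : nat -> R -> R) (s T : R),
  chain x0 y -> 0 <= s -> 1 <= T -> exists y' : nat -> R -> R,
  [/\ chain x0 y',
      forall k t, t < s -> y' k t = y k t,
      forall k t, s + T <= t -> y' k t = 0 &
      forall t, s <= t < s + T -> `|chain_state n y' t| <= C * T ^+ n * `|chain_state n y s| /\
        `|y' n t| <= C * `|chain_state n y s| / T].
Proof.
have [C [C0 CP]] := steering R n.
exists C; split => // x0 y s T yP s0 T1.
have T0 : 0 < T by apply: lt_le_trans T1.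
have [z [zP zT zB zn]] := CP (chain_state n y s) s T T1.
have y1P : chain x0 (glue s y z).
  apply: chain_glue => // i t st; have [? ->] := zP i t st; split => //.
  by rewrite mxE.
pose w (k : nat) (t : R) : R := 0.
have sT0 : 0 <= s + T by rewrite addr_ge0// ltW.
have sTs : (s + T < s) = false by apply/negbTE; rewrite -leNgt lerDl ltW.
exists (glue (s + T) (glue s y z) w); split.
- apply: chain_glue => // i t st; split.
    exact: integrable0.
  by rewrite /glue sTs zT add0r Rintegral_cst// mul0r.
- by move=> k t ts; rewrite /glue ts (lt_trans ts)// ltrDl.
- by move=> k t st; rewrite /glue ltNge st.
- move=> t /andP[st tsT].
  have tI : s <= t <= s + T by rewrite st ltW.
  have gz k : glue (s + T) (glue s y z) w k t = z k t.
    by rewrite /glue tsT ltNge st.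
  rewrite gz; split; last exact: zn.
  apply: col_norm_le => [|i]; first by rewrite !mulr_ge0// ?exprn_ge0 ?ltW.
  by rewrite mxE gz; exact: zB.
Qed.

End extension.

(** * Integrals over the half-line and step functions *)

Section halfline_integral.
Variable R : realType.
Local Notation mu := (@lebesgue_measure R).
Local Notation halfline := (`[0, +oo[%classic : set R).
Implicit Types f g : R -> R.

Lemma halflineP (t : R) : halfline t <-> 0 <= t.
Proof. by rewrite /= in_itv/= andbT. Qed.

(** Cost comparisons reduce to pointwise bounds: an increase of at most [c] on [[a, b]] raises the
    total cost by at most [c * (b - a)]. *)
Lemma integral_add_step g (c a b : R) : measurable_fun halfline g ->
  (forall t, 0 <= t -> 0 <= g t) -> 0 <= c -> 0 <= a <= b ->
  (\int[mu]_(t in halfline) (g t + c * \1_`[a, b]%classic t)%:E =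
   \int[mu]_(t in halfline) (g t)%:E + (c * (b - a))%:E)%E.
Proof.
move=> mg g0 c0 /andP[a0 ab].
have mi : measurable_fun halfline (\1_`[a, b]%classic : R -> R).
  exact: measurable_indic.
under eq_integral do rewrite EFinD.
rewrite ge0_integralD//; last 4 first.
- by move=> t /halflineP t0; rewrite lee_fin g0.
- exact/measurable_EFinP.
- by move=> t _; rewrite lee_fin mulr_ge0// indicE ler0n.
- by apply/measurable_EFinP/measurable_funM.
congr (_ + _)%E.
under eq_integral do rewrite EFinM.
rewrite ge0_integralZl_EFin//; last exact/measurable_EFinP.
rewrite integral_indic// setIidl; last first.
  by move=> t /=; rewrite !in_itv/= => /andP[/(le_trans a0) ->].
rewrite /= lebesgue_measure_itv/= lte_fin.
have [->|ab'] := eqVneq a b; first by rewrite ltxx mule0 subrr mulr0.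
by rewrite lt_neqAle ab' ab.
Qed.

Lemma integral_lower_step f (c a b : R) : measurable_fun halfline f ->
  0 <= c -> 0 <= a <= b -> (forall t, 0 <= t -> 0 <= f t) ->
  (forall t, a <= t <= b -> c <= f t) ->
  ((c * (b - a))%:E <= \int[mu]_(t in halfline) (f t)%:E)%E.
Proof.
move=> mf c0 ab f0 cf.
have := @integral_add_step (cst 0) c a b (measurable_cst _) _ c0 ab.
rewrite integral0 add0e => <-//.
apply: ge0_le_integral => //=.
- by move=> t _; rewrite lee_fin add0r mulr_ge0// indicE ler0n.
- apply/measurable_EFinP; apply: measurable_funD => //.
  by apply: measurable_funM => //; exact: measurable_indic.
- exact/measurable_EFinP.
- move=> t /halflineP t0; rewrite lee_fin add0r indicE mem_setE.
  case: (boolP (t \in _)) => [|_]; last by rewrite mulr0 f0.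
  by rewrite in_itv/= => tab; rewrite mulr1 cf.
Qed.

End halfline_integral.

(** * Truncating the control and repairing a trajectory *)

Section repair.
Variables (R : realType) (n : nat) (F : 'cV[R]_n -> R).
Local Notation mu := (@lebesgue_measure R).
Local Notation halfline := (`[0, +oo[%classic : set R).
Hypothesis n_gt0 : (0 < n)%N.
Hypothesis F_cont : continuous F.
Hypothesis F_convex : convex_function setT F.
Hypothesis F_posdef : positive_definite F.

Definition cost (y : nat -> R -> R) : \bar R :=
  (\int[mu]_(t in halfline) (F (chain_state n y t))%:E)%E.

Definition clip (v : R) : R := Num.max (-1) (Num.min 1 v).

Lemma clip_bound v : `|clip v| <= 1.
Proof.
have N11 : -1 <= 1 :> R by lra.
rewrite ler_norml /clip; case: (lerP 1 v) => v1; first by rewrite (max_r N11) N11 lexx.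
by case: (lerP (-1) v) => w1; rewrite ?w1 ?(ltW v1) ?lexx.
Qed.

Lemma clip_id v : `|v| <= 1 -> clip v = v.
Proof. by rewrite ler_norml => /andP[v1 v2]; rewrite /clip min_r// max_r. Qed.

Lemma clip_dist v : 1 <= `|v| -> `|v - clip v| = `|v| - 1.
Proof.
rewrite /clip; have [v0|v0] := lerP 0 v.
  rewrite (ger0_norm v0) => v1; rewrite (min_l v1) max_r; last by lra.
  by rewrite ger0_norm ?subr_ge0.
rewrite (ltr0_norm v0) => v1; rewrite min_r; last by lra.
rewrite max_l; last by lra.
by rewrite opprK ler0_norm; lra.
Qed.

Lemma measurable_clip D : measurable_fun D clip.
Proof. by apply: measurable_maxr => //; exact: measurable_minr. Qed.

Lemma measurable_chain_control (x0 : 'cV[R]_n) y : chain x0 y ->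
  measurable_fun halfline (y n).
Proof.
move=> yP; rewrite halfline_bigcup; apply/measurable_fun_bigcup => // k.
have := @chain_integrable _ _ x0 y n k%:R yP (ler0n _ _).
by rewrite n_gt0 leqnn => /(_ isT)/(measurable_int mu)/measurable_EFinP.
Qed.

Lemma integrable_clip (x0 : 'cV[R]_n) y t : chain x0 y -> 0 <= t ->
  mu.-integrable `[0, t] (EFin \o (clip \o y n)).
Proof.
move=> yP t0; have yi : mu.-integrable `[0, t] (EFin \o y n).
  by apply: (chain_integrable yP t0); rewrite n_gt0 leqnn.
have /measurable_EFinP my := measurable_int mu yi.
apply: measurable_bounded_integrable => //.
- by rewrite /= lebesgue_measure_itv/=; case: ifP => // _; rewrite -EFinB ltry.
- by apply: measurableT_comp => //; exact: measurable_clip.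
- exists 1; split; first exact: num_real.
  by move=> M M1 s _; apply: le_trans (ltW M1); exact: clip_bound.
Qed.

(* A state of small running cost must occur before time T; there the state is
   small, and it can be steered to 0 in unit time by a small control. *)
Lemma chain_repair (B M e : R) : 0 <= B -> 0 < e -> exists T k : R, 0 <= T /\ 0 < k /\
  forall (x0 : 'cV[R]_n) y, `|x0| <= B -> chain x0 y -> (cost y <= M%:E)%E ->
  \int[mu]_(t in `[0, T]) `|y n t - clip (y n t)| <= k ->
  exists y', [/\ chain x0 y', forall t, 0 <= t -> `|y' n t| <= 1,
    forall t, T + 1 <= t -> y' n t = 0 & (cost y' <= cost y + e%:E)%E].
Proof.
move=> B0 e0.
have F0 := positive_definite_ge0 F_posdef.
have [C [C0 steer]] := chain_steer R n.
have [L0 [L00 FL0]] := convex_locally_lipschitz F_cont F_convex F_posdef 0.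
(* This radius gives a steering arc that starts at norm at most [2 * r] a control bounded by 1
   ([Cr1]) and a cost at most [e / 2] ([CrL]). *)
pose r := (2 * C * (1 + 2 * L0 / e))^-1.
have q0 : 0 < 2 * L0 / e by rewrite divr_gt0// mulr_gt0.
have rC0 : 0 < 2 * C * (1 + 2 * L0 / e) by rewrite !mulr_gt0// addr_gt0.
have r0 : 0 < r by rewrite invr_gt0.
have rE : r * (2 * C) * (1 + 2 * L0 / e) = 1.
  by rewrite -mulrA mulVf// gt_eqF.
clearbody r.
have Cr1 : C * (2 * r) <= 1.
  rewrite -[leRHS]rE [X in X <= _](_ : _ = r * (2 * C) * 1); last by ring.
  by rewrite ler_wpM2l ?lerDl ?ltW// !mulr_gt0.
have CrL : C * (2 * r) * L0 <= e / 2.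
  rewrite -(@ler_pM2r _ (2 / e)) ?divr_gt0//.
  have -> : e / 2 * (2 / e) = 1 by field; rewrite gt_eqF.
  rewrite -[leRHS]rE [X in X <= _](_ : _ = r * (2 * C) * (2 * L0 / e)); last by ring.
  by rewrite ler_wpM2l ?lerDr// !mulr_ge0// ltW.
have [m [m0 Fm]] := convex_posdef_coercive F_cont F_convex F_posdef r0.
(* A running cost above [m] on all of [[0, T]] would make the total cost at least [|M| + 1], hence
   above [M]. *)
pose T := (`|M| + 1) / m.
have T0 : 0 < T by rewrite divr_gt0// ltr_wpDl.
have Tm : T * m = `|M| + 1 by rewrite divfK// gt_eqF.
clearbody T.
pose G := (1 + T) ^+ n.
have G0 : 0 < G by rewrite exprn_gt0// addr_gt0.
(* The truncated control has L^1 norm at most [T] on [[0, T]], so its trajectory stays in the ball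
   of radius [G * (B + T)]; the original one stays within distance 1 of it. *)
have [L [LL0 FL]] := convex_locally_lipschitz F_cont F_convex F_posdef (G * (B + T) + 1).
(* The three summands make [d = 1 / K] satisfy [d <= 1], [d <= r] and [d * L * T <= e / 2]
   respectively. *)
pose K := 1 + r^-1 + 2 * L * T / e.
have LTe0 : 0 <= 2 * L * T / e by rewrite ltW// divr_gt0// !mulr_gt0.
have ri0 : 0 < r^-1 by rewrite invr_gt0.
have K0 : 0 < K by rewrite /K; lra.
pose d := K^-1.
have d0 : 0 < d by rewrite invr_gt0.
have dK : d * K = 1 by rewrite mulVf// gt_eqF.
clearbody d.
have d1 : d <= 1.
  by rewrite -[leRHS]dK ler_peMr ?ltW// /K; lra.
have dr : d <= r.
  rewrite -(@ler_pM2r _ r^-1)// mulfV ?gt_eqF// -[leRHS]dK ler_wpM2l ?ltW// /K; lra.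
have dLT : d * L <= e / 2 / T.
  rewrite ler_pdivlMr// -(@ler_pM2r _ (2 / e)) ?divr_gt0//.
  have -> : e / 2 * (2 / e) = 1 by field; rewrite gt_eqF.
  rewrite -[leRHS]dK [X in X <= _](_ : _ = d * (2 * L * T / e)); last by ring.
  by rewrite ler_wpM2l ?ltW// /K; lra.
(* An L^1 change [d / G] of the control, amplified by the factor [G] of [chain_bound], moves the
   state by at most [d]. *)
exists T, (d / G); split; [exact: ltW|split; first exact: divr_gt0].
move=> x0 y x0B yP yM uk.
have [y1 [y1P y1n]] : exists y1, chain x0 y1 /\ y1 n = clip \o y n.
  by apply: chain_exists => t t0; exact: (integrable_clip yP).
have x0Bi i : `|x0 i 0| <= B by apply: le_trans x0B; exact: col_norm_coord.
have uT : mu.-integrable `[0, T] (EFin \o (clip \o y n)).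
  exact: (integrable_clip yP (ltW T0)).
have GBT0 : 0 <= G * (B + T) by apply: mulr_ge0; [exact: ltW|apply: addr_ge0 => //; exact: ltW].
have y1B t : 0 <= t <= T -> `|chain_state n y1 t| <= G * (B + T).
  move=> tT; apply: col_norm_le => [|i]; first exact: GBT0.
  rewrite mxE; apply: le_trans (chain_bound y1P n_gt0 (ltW T0) x0Bi i tT) _.
  apply: ler_wpM2l; first exact: ltW.
  rewrite lerD2l y1n.
  apply: (@le_trans _ _ (\int[mu]_(s in `[0, T]) 1)).
    apply: le_Rintegral => //; first exact: integrable_norm.
    - apply: continuous_compact_integrable; first exact: segment_compact.
      exact/continuous_subspaceT/cst_continuous.
    - by move=> s _; exact: clip_bound.
  by rewrite Rintegral_cst//= lebesgue_measure_itv/= lte_fin T0 /= subr0 mul1r.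
have ydist t : 0 <= t <= T -> `|chain_state n y1 t - chain_state n y t| <= d.
  move=> tT; apply: col_norm_le => [|i]; first exact: ltW.
  have := chain_bound (chainB y1P yP) n_gt0 (ltW T0) _ i tT => /(_ 0).
  rewrite !mxE => /(_ _)/le_trans; apply; first by move=> j; rewrite subrr mxE normr0.
  have dG : d = G * (d / G) by rewrite mulrC divfK// gt_eqF.
  rewrite add0r [leRHS]dG; apply: ler_wpM2l; first exact: ltW.
  apply: le_trans uk; rewrite le_eqVlt; apply/orP; left; apply/eqP.
  by apply: eq_Rintegral => s _; rewrite y1n distrC.
have F01 t : 0 <= t <= T -> F (chain_state n y1 t) <= F (chain_state n y t) + e / 2 / T.
  move=> tT; have yd := ydist _ tT.
  have yB : `|chain_state n y t| <= G * (B + T) + 1.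
    rewrite -[X in `|X|](subrK (chain_state n y1 t)).
    apply: le_trans (ler_normD _ _) _; rewrite addrC lerD ?y1B// distrC.
    exact: le_trans yd d1.
  apply: le_trans (FL _ _ yB (le_trans yd d1)) _; rewrite lerD2l.
  by apply: le_trans dLT; rewrite ler_wpM2r// ltW.
have mF := measurable_fun_chain_cost F_cont yP.
have [s [sT ys]] : exists s, 0 <= s <= T /\ F (chain_state n y s) <= m.
  apply: contrapT => H.
  have Hs s : 0 <= s <= T -> m <= F (chain_state n y s).
    by move=> sT; rewrite leNgt; apply/negP => /ltW ys; apply: H; exists s.
  have TT : 0 <= (0 : R) <= T by rewrite lexx ltW.
  have := integral_lower_step mF (ltW m0) TT (fun t _ => F0 _) Hs.
  move=> /le_trans/(_ yM); rewrite lee_fin subr0 mulrC Tm.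
  by have := ler_norm M; lra.
have xs : `|chain_state n y1 s| <= 2 * r.
  rewrite -[X in `|X|](subrK (chain_state n y s)).
  apply: le_trans (ler_normD _ _) _; rewrite mulr_natl mulr2n.
  by apply: lerD; [exact: le_trans (ydist _ sT) dr|exact: Fm].
have [s0 sleT] := andP sT.
have [y' [y'P y'1 y'3 y'2]] := steer x0 y1 s 1 y1P s0 (lexx _).
have Cxs : C * `|chain_state n y1 s| <= C * (2 * r) by rewrite ler_wpM2l// ltW.
exists y'; split=> //.
- move=> t t0; have [ts|st] := ltP t s; first by rewrite y'1// y1n; exact: clip_bound.
  have [ts1|s1t] := ltP t (s + 1); last by rewrite y'3// normr0.
  have [|_] := y'2 t; first by rewrite st.
  by move=> /le_trans; apply; rewrite divr1 (le_trans Cxs).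
- by move=> t Tt; rewrite y'3// (le_trans _ Tt)// lerD2r.
- have step0 (c a b t : R) : 0 <= c -> 0 <= c * \1_`[a, b]%classic t.
    by move=> c0; rewrite mulr_ge0// indicE ler0n.
  have eT0 : 0 <= e / 2 / T by rewrite !divr_ge0// ltW.
  have e20 : 0 <= e / 2 by rewrite divr_ge0// ltW.
  (* The budget [e] is split in two: one half is spread over [[0, T]] for the effect of truncation,
     the other is spent on the steering interval of length 1. *)
  pose g t := F (chain_state n y t) + e / 2 / T * \1_`[0, T]%classic t.
  have mg : measurable_fun halfline g.
    by apply: measurable_funD => //; apply: measurable_funM => //; exact: measurable_indic.
  apply: (@le_trans _ _ (\int[mu]_(t in halfline)
      (g t + e / 2 * \1_`[s, s + 1]%classic t)%:E)%E); last first.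
    rewrite integral_add_step//; last 2 first.
    + by move=> t t0; rewrite addr_ge0// step0.
    + by rewrite s0 lerDl ler01.
    rewrite integral_add_step//; last by rewrite lexx ltW.
    have -> : s + 1 - s = 1 by ring.
    by rewrite subr0 divfK ?gt_eqF// mulr1 -addeA -EFinD -splitr.
  apply: ge0_le_integral => //=.
  + by move=> t _; rewrite lee_fin.
  + apply/measurable_EFinP; exact: (measurable_fun_chain_cost F_cont y'P).
  + apply/measurable_EFinP; apply: measurable_funD => //.
    by apply: measurable_funM => //; exact: measurable_indic.
  + move=> t /halflineP t0; rewrite lee_fin.
    have [ts|st] := ltP t s.
      have tT : 0 <= t <= T by rewrite t0 (le_trans (ltW ts)).
      have -> : chain_state n y' t = chain_state n y1 t by apply/colP => i; rewrite !mxE y'1.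
      rewrite /g [\1_`[0, T]%classic t]indicE mem_setE in_itv/= tT mulr1.
      by apply: le_trans (F01 _ tT) _; rewrite lerDl step0.
    have [ts1|s1t] := ltP t (s + 1); last first.
      have -> : chain_state n y' t = 0 by apply/colP => i; rewrite !mxE y'3.
      by rewrite F_posdef.1 addr_ge0// ?addr_ge0// step0.
    have [|y't _] := y'2 t; first by rewrite st.
    rewrite expr1n mulr1 in y't.
    have y'r : `|chain_state n y' t| <= C * (2 * r) by apply: le_trans y't Cxs.
    have -> : \1_`[s, s + 1]%classic t = 1 :> R.
      by rewrite indicE mem_setE in_itv/= st ltW.
    rewrite mulr1; apply: (@le_trans _ _ (e / 2)); last first.
      by rewrite lerDr /g addr_ge0// step0.
    have := FL0 0 (chain_state n y' t).
    rewrite normr0 subr0 F_posdef.1 add0r => /(_ (lexx _))/(_ (le_trans y'r Cr1)).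
    move=> /le_trans; apply; apply: le_trans CrL.
    by rewrite ler_wpM2r// ltW.
Qed.

End repair.

(** * Comparison of the two value functions *)

Section values.
Variables (R : realType) (n : nat) (F : 'cV[R]_n -> R).
Local Notation mu := (@lebesgue_measure R).
Local Notation halfline := (`[0, +oo[%classic : set R).
Hypothesis n_gt0 : (0 < n)%N.
Hypothesis F_cont : continuous F.
Hypothesis F_convex : convex_function setT F.
Hypothesis F_posdef : positive_definite F.

Lemma powR_norm_le1 (v q : R) : `|v| <= 1 -> 0 <= q -> `|v| `^ q <= 1.
Proof.
move=> v1 q0; have -> : 1 = 1 `^ q :> R by rewrite powR1.
by apply: ge0_ler_powR; rewrite ?nnegrE.
Qed.

(** With [w = |v| - 1], the inequality [w <= a + w^2 / a] turns the quadratic Bernoulli bound into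
    one that can be integrated: over a bounded interval the excess is a small multiple of its length
    plus [4 / (q * a)] times the control cost. *)
Lemma excess_le (q a v : R) : 2 < q -> 0 < a ->
  `|v - clip v| <= a + 4 / (q * a) * (`|v| `^ q / q).
Proof.
move=> q2 a0; have q0 : 0 < q by lra.
have h0 : 0 <= 4 / (q * a) * (`|v| `^ q / q).
  by rewrite !mulr_ge0 ?invr_ge0 ?powR_ge0 ?mulr_ge0// ltW.
have [v1|v1] := leP `|v| 1.
  by rewrite clip_id// subrr normr0 addr_ge0// ltW.
rewrite clip_dist; last exact: ltW.
set w := `|v| - 1.
have w0 : 0 <= w by rewrite subr_ge0 ltW.
(* Young's inequality against 1 is Bernoulli's inequality for the exponent q / 2 *)
have bernoulli : 1 + q / 2 * w <= `|v| `^ (q / 2).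
  have p1 : (q / 2)^-1 + ((q / 2) / (q / 2 - 1))^-1 = 1.
    by field; apply/andP; split; rewrite gt_eqF//; lra.
  have p2 : 0 < (q / 2) / (q / 2 - 1) by rewrite divr_gt0//; lra.
  have p0 : 0 < q / 2 by lra.
  have := conjugate_powR (normr_ge0 v) ler01 p0 p2 p1.
  rewrite powR1 mulr1 [(q / 2 / _)^-1]invf_div mul1r => H.
  rewrite -(@ler_pM2r _ (q / 2)^-1) ?invr_gt0//.
  rewrite -(@lerD2r _ ((q / 2 - 1) / (q / 2))). apply: le_trans H.
  by rewrite le_eqVlt; apply/orP; left; apply/eqP; rewrite /w; field; rewrite gt_eqF.
have sq : (q / 2 * w) ^+ 2 <= `|v| `^ q.
  have -> : `|v| `^ q = (`|v| `^ (q / 2)) ^+ 2.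
    by rewrite -powR_mulrn ?powR_ge0// -powRrM divfK.
  have qw0 : 0 <= q / 2 * w by rewrite mulr_ge0// divr_ge0// ltW.
  rewrite ler_sqr ?nnegrE ?powR_ge0//; lra.
clearbody w.
have -> : 4 / (q * a) * (`|v| `^ q / q) = 4 / (q ^+ 2 * a) * `|v| `^ q.
  by field; rewrite !gt_eqF.
apply: (@le_trans _ _ (a + w ^+ 2 / a)); last first.
  rewrite lerD2l [leLHS](_ : _ = 4 / (q ^+ 2 * a) * (q / 2 * w) ^+ 2); last first.
    by field; rewrite !gt_eqF.
  by rewrite ler_wpM2l// divr_ge0// mulr_ge0 ?exprn_ge0// ltW.
rewrite -(@ler_pM2r _ a)// mulrDl divfK ?gt_eqF//.
have := sqr_ge0 (a - w); nra.
Qed.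

(** A repaired control is thus admissible in both problems at once, which lets a trajectory pass
    from either one to the other. *)
Lemma control_of_bounded (u : R -> R) (T q : R) : measurable_fun halfline u ->
  (forall t, 0 <= t -> `|u t| <= 1) -> (forall t, T <= t -> u t = 0) -> 1 < q ->
  control_Lq q u /\ control_Linf1 u.
Proof.
move=> mu1 u1 uT q1.
have mf : measurable_fun setT (u \_ halfline).
  by apply: (measurable_restrictT u (measurable_itv _)).1.
have f1 t : `|(u \_ halfline) t| <= 1.
  rewrite patchE; case: ifPn => [|_]; last by rewrite normr0.
  by rewrite inE /= in_itv/= andbT; exact: u1.
have q0 : 0 < q by lra.
split.
- apply/andP; split; rewrite inE//= /finite_norm unlock; apply: poweR_lty.
  apply: (@le_lt_trans _ _ (\int[mu]_t (\1_`[0, T]%classic t)%:E)%E).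
    apply: ge0_le_integral => //=.
    + apply/measurable_EFinP; apply: (measurableT_comp (measurable_powR q)).
      exact: measurableT_comp.
    + by apply/measurable_EFinP; exact: measurable_indic.
    + move=> t _; rewrite lee_fin indicE mem_setE in_itv/=.
      case: (boolP (0 <= t <= T)) => [_|]; first by rewrite powR_norm_le1// ltW.
      rewrite negb_and -!ltNge => tT; rewrite patchE; case: ifPn => [|_].
        rewrite inE /= in_itv/= andbT => t0; rewrite uT ?normr0 ?powR0 ?gt_eqF//.
        by move: tT; rewrite ltNge t0/= => /ltW.
      by rewrite normr0 powR0// gt_eqF.
  rewrite integral_indic// setIT /= lebesgue_measure_itv/=.
  by case: ifP => // _; rewrite -EFinB ltry.
- split; last by apply: aeW => t t0; rewrite in_itv/= -ler_norml u1.
  apply/andP; split; rewrite inE//= /finite_norm unlock; case: ifP => // _.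
  apply: (@le_lt_trans _ _ 1%E); last exact: ltry.
  by apply/ess_supP/aeW => t /=; rewrite lee_fin.
Qed.

Lemma value_lim_le (x0 : 'cV[R]_n) y T : chain x0 y ->
  (forall t, 0 <= t -> `|y n t| <= 1) -> (forall t, T <= t -> y n t = 0) ->
  (value_lim F x0 <= cost F y)%E.
Proof.
move=> yP y1 yT; apply: ereal_inf_lbound.
exists (y n), (chain_state n y); split => //; last exact: trajectory_of_chain.
have q1 : 1 < 2 :> R by lra.
by have [_] := control_of_bounded (measurable_chain_control n_gt0 yP) y1 yT q1.
Qed.

Lemma value_q_le (x0 : 'cV[R]_n) y (T q : R) : 0 <= T -> 1 < q -> chain x0 y ->
  (forall t, 0 <= t -> `|y n t| <= 1) -> (forall t, T <= t -> y n t = 0) ->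
  (value_q F q x0 <= cost F y + (T / q)%:E)%E.
Proof.
move=> T0 q1 yP y1 yT; have q0 : 0 < q by lra.
have mu1 := measurable_chain_control n_gt0 yP.
have mF := measurable_fun_chain_cost F_cont yP.
apply: (@le_trans _ _ (\int[mu]_(t in halfline)
    (`|y n t| `^ q / q + F (chain_state n y t))%:E)%E).
  apply: ereal_inf_lbound; exists (y n), (chain_state n y).
  by split => //; [have [] := control_of_bounded mu1 y1 yT q1|exact: trajectory_of_chain].
have T00 : 0 <= (0 : R) <= T by rewrite lexx.
have qi0 : 0 <= q^-1 by rewrite invr_ge0 ltW.
have := integral_add_step mF (fun t _ => positive_definite_ge0 F_posdef _) qi0 T00.
rewrite subr0 (mulrC _ T) => <-.
have pow0 t : 0 <= `|y n t| `^ q / q by rewrite divr_ge0 ?powR_ge0// ltW.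
apply: ge0_le_integral => //=.
- by move=> t _; rewrite lee_fin addr_ge0// positive_definite_ge0.
- apply/measurable_EFinP; apply: measurable_funD => //.
  apply: measurable_funM => //; apply: (measurableT_comp (measurable_powR q)).
  exact: measurableT_comp.
- apply/measurable_EFinP; apply: measurable_funD => //.
  by apply: measurable_funM => //; exact: measurable_indic.
- move=> t /halflineP t0; rewrite lee_fin addrC lerD2l.
  have [tT|/ltW Tt] := leP t T.
    rewrite indicE mem_setE in_itv/= t0 tT mulr1.
    by rewrite ler_piMl// powR_norm_le1 ?y1// ltW.
  by rewrite yT// normr0 powR0 ?gt_eqF// mul0r mulr_ge0// indicE.
Qed.

Lemma value_lim_ge0 x0 : (0 <= value_lim F x0)%E.
Proof.
apply: le_ereal_inf_tmp => _ [u [x [_ _ ->]]].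
by apply: integral_ge0 => t _; rewrite lee_fin positive_definite_ge0.
Qed.

Lemma value_q_ge0 q x0 : 1 < q -> (0 <= value_q F q x0)%E.
Proof.
move=> q1; apply: le_ereal_inf_tmp => _ [u [x [_ _ ->]]].
apply: integral_ge0 => t _; rewrite lee_fin addr_ge0 ?positive_definite_ge0//.
by rewrite divr_ge0 ?powR_ge0//; lra.
Qed.

(** Slow steering suffices: over a time [T = 1 + C * B] the control bound [C * |x0| / T] is at most
    1, and the state stays in a fixed ball, where [F] is bounded. *)
Lemma chain_to_origin (B : R) : 0 <= B -> exists T M : R, 0 <= T /\
  forall x0 : 'cV[R]_n, `|x0| <= B -> exists y, [/\ chain x0 y,
    forall t, 0 <= t -> `|y n t| <= 1, forall t, T <= t -> y n t = 0 &
    (cost F y <= M%:E)%E].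
Proof.
move=> B0; have [C [C0 steer]] := chain_steer R n.
pose T := 1 + C * B.
have CB0 : 0 <= C * B by rewrite mulr_ge0// ltW.
have T1 : 1 <= T by rewrite lerDl.
have T0 : 0 < T by apply: lt_le_trans T1.
have [M [M0 FM]] := bounded_on_balls F_cont F_posdef (C * T ^+ n * B).
exists T, (M * T); split; first exact: ltW.
move=> x0 x0B.
(* The uncontrolled chain only supplies the state [x0] at time 0, where steering begins. *)
have [y0 [y0P _]] : exists y, chain x0 y /\ y n = cst 0.
  by apply: chain_exists => t t0; exact: integrable0.
have [y [yP _ yT yb]] := steer x0 y0 0 T y0P (lexx _) T1.
have y0x : chain_state n y0 0 = x0.
  by apply/colP => i; rewrite mxE (chain_initial i y0P).
rewrite add0r y0x in yT yb.
have CTn0 : 0 <= C * T ^+ n by rewrite mulr_ge0 ?exprn_ge0// ltW.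
exists y; split=> //.
- move=> t t0; have [tT|Tt] := ltP t T; last by rewrite yT// normr0.
  have [|_ /le_trans] := yb t; first by rewrite t0.
  apply; rewrite ler_pdivrMr// mul1r; apply: (@le_trans _ _ (C * B)).
    by rewrite ler_wpM2l// ltW.
  by rewrite lerDr.
- by move=> t Tt; exact: yT.
- have mF := measurable_fun_chain_cost F_cont yP.
  have T00 : 0 <= (0 : R) <= T by rewrite lexx ltW.
  have := @integral_add_step R (cst 0) M 0 T (measurable_cst _) _ (ltW M0) T00.
  rewrite integral0 add0e subr0 => <-//.
  apply: ge0_le_integral => //=.
  + by move=> t _; rewrite lee_fin positive_definite_ge0.
  + exact/measurable_EFinP.
  + apply/measurable_EFinP; apply: measurable_funD => //.
    by apply: measurable_funM => //; exact: measurable_indic.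
  + move=> t /halflineP t0; rewrite lee_fin add0r.
    have [tT|Tt] := ltP t T; last first.
      have -> : chain_state n y t = 0 by apply/colP => i; rewrite !mxE yT.
      by rewrite F_posdef.1 mulr_ge0 ?(ltW M0)// indicE.
    rewrite indicE mem_setE in_itv/= t0 (ltW tT) mulr1; apply: FM.
    have [|/le_trans + _] := yb t; first by rewrite t0.
    by apply; rewrite ler_wpM2l.
Qed.

(** Independence of [q] is the point: the time and the tolerance produced by [chain_repair] depend
    on this bound and must be fixed before [q]. *)
Lemma value_uniform_bound (B : R) : 0 <= B -> exists M : R,
  forall x0 : 'cV[R]_n, `|x0| <= B -> (value_lim F x0 <= M%:E)%E /\
    forall q, 1 < q -> (value_q F q x0 <= M%:E)%E.
Proof.
move=> B0; have [T [M [T0 H]]] := chain_to_origin B0.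
exists (M + T) => x0 /H[y [yP y1 yT yM]]; split.
  apply: le_trans (value_lim_le yP y1 yT) _; apply: le_trans yM _.
  by rewrite lee_fin lerDl.
move=> q q1; apply: le_trans (value_q_le T0 q1 yP y1 yT) _.
rewrite EFinD; apply: leeD => //; rewrite lee_fin ler_pdivrMr; last by lra.
by rewrite ler_peMr// ltW.
Qed.

Lemma value_lim_fin_num x0 : value_lim F x0 \is a fin_num.
Proof.
have [M /(_ x0 (lexx _))[vM _]] := value_uniform_bound (normr_ge0 x0).
by rewrite ge0_fin_numE ?value_lim_ge0// (le_lt_trans vM)// ltry.
Qed.

Lemma value_q_fin_num q x0 : 1 < q -> value_q F q x0 \is a fin_num.
Proof.
move=> q1; have [M /(_ x0 (lexx _))[_ vM]] := value_uniform_bound (normr_ge0 x0).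
by rewrite ge0_fin_numE ?value_q_ge0// (le_lt_trans (vM q q1))// ltry.
Qed.

Lemma integrable_clip_excess (x0 : 'cV[R]_n) y t : chain x0 y -> 0 <= t ->
  mu.-integrable `[0, t] (EFin \o (fun s => y n s - clip (y n s))).
Proof.
move=> yP t0; have iy : mu.-integrable `[0, t] (EFin \o y n).
  by apply: (chain_integrable yP t0); rewrite n_gt0 leqnn.
by apply: eq_integrable (integrableB _ iy (integrable_clip n_gt0 yP t0)).
Qed.

(** A near-optimal control of the limit problem lies in [[-1, 1]] almost everywhere, so its
    truncation excess vanishes. The repair is still needed to make it vanish after a fixed time,
    which keeps its L^q cost of order [1 / q]. *)
Lemma value_q_upper (B e : R) : 0 <= B -> 0 < e -> exists T : R, 0 <= T /\
  forall q (x0 : 'cV[R]_n), 1 < q -> `|x0| <= B ->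
  (value_q F q x0 <= value_lim F x0 + (e + T / q)%:E)%E.
Proof.
move=> B0 e0; have e20 : 0 < e / 2 by lra.
have [M Mb] := value_uniform_bound B0.
have [T [k [T0 [k0 repair]]]] :=
  chain_repair n_gt0 F_cont F_convex F_posdef (M + e / 2) B0 e20.
exists (T + 1); split; first by rewrite addr_ge0.
move=> q x0 q1 x0B; have [vM _] := Mb x0 x0B.
have [_ [u [x [[_ uae] xP ->]]] uxv] := lb_ereal_inf_adherent e20 (value_lim_fin_num x0).
have yP := chain_of_trajectory xP.
set y := coord_chain u x in yP.
have yn : y n = u by exact: coord_chain_last.
have yv : (cost F y < value_lim F x0 + (e / 2)%:E)%E.
  by rewrite /cost chain_state_coord.
have yM : (cost F y <= (M + e / 2)%:E)%E.
  by apply: le_trans (ltW yv) _; rewrite EFinD leeD2r.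
have yk : \int[mu]_(t in `[0, T]) `|y n t - clip (y n t)| <= k.
  suff -> : \int[mu]_(t in `[0, T]) `|y n t - clip (y n t)| = 0 by exact: ltW.
  have iw := integrable_clip_excess yP T0.
  rewrite /Rintegral (_ : (\int[mu]_(t in _) _)%E = 0%E)//.
  have [_] := ae_eq_integral_abs mu (measurable_itv _) (measurable_int mu iw).
  apply.
  have FF : Filter (nbhs (almost_everywhere mu)) by exact: ae_filter_ringOfSetsType.
  apply: filterS uae => t tu /=; rewrite in_itv/= => /andP[t0 _].
  by rewrite yn clip_id ?subrr// ler_norml; have := tu t0; rewrite in_itv.
have [y' [y'P y'1 y'T y'c]] := repair x0 y x0B yP yM yk.
apply: le_trans (value_q_le _ q1 y'P y'1 y'T) _; first by rewrite addr_ge0.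
rewrite [(e + _)%:E]EFinD addeA leeD2r//; apply: le_trans y'c _.
by rewrite [in leRHS](splitr e) EFinD addeA leeD2r// ltW.
Qed.

(** The L^q cost of a near-optimal control is at most [M'] for every [q], so its excess over
    [[0, T]] is at most [a * T + 4 * M' / (q * a)], which falls below [k] for large [q]. *)
Lemma value_q_lower (B e : R) : 0 <= B -> 0 < e -> exists Q : R,
  forall q (x0 : 'cV[R]_n), Q < q -> 1 < q -> `|x0| <= B ->
  (value_lim F x0 <= value_q F q x0 + e%:E)%E.
Proof.
move=> B0 e0; have e20 : 0 < e / 2 by lra.
have [M Mb] := value_uniform_bound B0.
pose M' := `|M + e / 2|.
have M'0 : 0 <= M' by exact: normr_ge0.
have [T [k [T0 [k0 repair]]]] :=
  chain_repair n_gt0 F_cont F_convex F_posdef M' B0 e20.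
(* This keeps [a * T] below [k / 2]; the [+ 1] avoids a division by zero when [T = 0]. *)
pose a := k / (2 * (T + 1)).
have T10 : 0 < T + 1 by lra.
have a0 : 0 < a by rewrite divr_gt0// mulr_gt0.
have aT : a * T <= k / 2.
  have -> : k / 2 = a * (T + 1) by rewrite /a; field; rewrite gt_eqF.
  by apply: ler_wpM2l; [exact: ltW|rewrite lerDl].
clearbody a.
(* The 2 meets the hypothesis of [excess_le], and the fraction makes [4 * M' / (q * a)] at most
   [k / 2]. *)
exists (2 + 8 * M' / (a * k)) => q x0 Qq q1 x0B; have [_ /(_ q q1) vM] := Mb x0 x0B.
have ak0 : 0 < a * k by rewrite mulr_gt0.
have Q0 : 0 <= 8 * M' / (a * k) by apply: divr_ge0; [exact: mulr_ge0|exact: ltW].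
have q2 : 2 < q by lra.
have q0 : 0 < q by lra.
have [_ [u [x [_ xP ->]]] uxv] := lb_ereal_inf_adherent e20 (value_q_fin_num x0 q1).
have yP := chain_of_trajectory xP.
set y := coord_chain u x in yP.
have yn : y n = u by exact: coord_chain_last.
pose h t := `|y n t| `^ q / q + F (chain_state n y t).
have h_ge t : `|y n t| `^ q / q <= h t by rewrite lerDl positive_definite_ge0.
have Fh t : F (chain_state n y t) <= h t by rewrite lerDr divr_ge0 ?powR_ge0// ltW.
have h0 t : 0 <= h t by apply: le_trans (Fh t); exact: positive_definite_ge0.
have mF := measurable_fun_chain_cost F_cont yP.
have mh : measurable_fun halfline h.
  apply: measurable_funD => //; apply: measurable_funM => //.
  apply: (measurableT_comp (measurable_powR q)); apply: measurableT_comp => //.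
  exact: (measurable_chain_control n_gt0 yP).
have hv : (\int[mu]_(t in halfline) (h t)%:E < value_q F q x0 + (e / 2)%:E)%E.
  by rewrite /h yn chain_state_coord.
have yh : (cost F y <= \int[mu]_(t in halfline) (h t)%:E)%E.
  apply: ge0_le_integral => //=.
  - by move=> t _; rewrite lee_fin positive_definite_ge0.
  - exact/measurable_EFinP.
  - exact/measurable_EFinP.
  - by move=> t _; rewrite lee_fin.
have hM : (\int[mu]_(t in halfline) (h t)%:E <= M'%:E)%E.
  apply: le_trans (ltW hv) _; apply: (@le_trans _ _ (M + e / 2)%:E).
    by rewrite EFinD leeD2r.
  by rewrite lee_fin ler_norm.
have yk : \int[mu]_(t in `[0, T]) `|y n t - clip (y n t)| <= k.
  have iw := integrable_norm (integrable_clip_excess yP T0).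
  pose K := 4 / (q * a).
  have K0 : 0 <= K by rewrite divr_ge0// mulr_ge0// ltW.
  have KM : K * M' <= k / 2.
    rewrite /K mulrAC ler_pdivrMr ?mulr_gt0//.
    have : 8 * M' / (a * k) < q by lra.
    rewrite ltr_pdivrMr//; nra.
  have Kv t : `|y n t - clip (y n t)| <= a + K * (`|y n t| `^ q / q).
    exact: excess_le.
  clearbody K.
  have TH : `[0, T]%classic `<=` halfline by move=> t /=; rewrite !in_itv/= andbT => /andP[].
  have mhT : measurable_fun `[0, T] h by apply: measurable_funS mh.
  have wK : (\int[mu]_(t in `[0%R, T]) (`|y n t - clip (y n t)|)%:E <=
      (a * T + K * M')%:E)%E.
    apply: (@le_trans _ _ (\int[mu]_(t in `[0%R, T]) (a%:E + K%:E * (h t)%:E))%E).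
      apply: ge0_le_integral => //=.
      - exact: (measurable_int mu iw).
      - apply/measurable_EFinP; apply: measurable_funD => //.
        exact: measurable_funM.
      - move=> t _; rewrite -EFinM -EFinD lee_fin.
        apply: le_trans (Kv t) _; rewrite lerD2l.
        by rewrite ler_wpM2l// h_ge.
    rewrite ge0_integralD//; last 3 first.
    - by move=> t _; rewrite lee_fin ltW.
    - by move=> t _; rewrite -EFinM lee_fin mulr_ge0.
    - by apply/measurable_EFinP; exact: measurable_funM.
    rewrite integral_cst//= lebesgue_measure_itv/= EFinD; apply: leeD.
      by case: ifP => _; rewrite -?EFinB -?EFinM lee_fin ?subr0// mulr0 mulr_ge0// ltW.
    rewrite ge0_integralZl_EFin//; last 2 first.
    - by move=> t _; rewrite lee_fin.
    - exact/measurable_EFinP.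
    rewrite EFinM; apply: lee_wpmul2l; first by rewrite lee_fin.
    apply: le_trans hM.
    apply: ge0_subset_integral => //; first exact/measurable_EFinP.
    by move=> t _; rewrite lee_fin.
  rewrite -lee_fin /Rintegral fineK; last exact: (integrable_fin_num _ iw).
  by apply: le_trans wK _; rewrite lee_fin; lra.
have [y' [y'P y'1 y'T y'c]] := repair x0 y x0B yP (le_trans yh hM) yk.
apply: le_trans (value_lim_le y'P y'1 y'T) _; apply: le_trans y'c _.
rewrite [in leRHS](splitr e) EFinD addeA leeD2r//.
exact: le_trans yh (ltW hv).
Qed.

End values.

(** * Uniform convergence on compact sets from the two one-sided estimates *)

Theorem mainTheorem14 (R : realType) (n : nat) (hn : (1 <= n)%N)
    (F : 'cV[R]_n -> R)
    (F_C1 : continuously_differentiable F)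
    (F_convex : convex_function setT F)
    (F_posdef : positive_definite F) :
  [/\ forall (q : R) (x0 : 'cV[R]_n), 1 < q -> value_q F q x0 \is a fin_num,
      forall x0 : 'cV[R]_n, value_lim F x0 \is a fin_num &
      {family compact,
        (fun (q : R) (x0 : 'cV[R]_n) => fine (value_q F q x0)) @ +oo -->
        (fun x0 : 'cV[R]_n => fine (value_lim F x0))}].
Proof.
have F_cont : continuous F.
  by move=> x; apply: differentiable_continuous; exact: F_C1.1.
have lim_fin := value_lim_fin_num hn F_cont F_posdef.
have q_fin := value_q_fin_num hn F_cont F_posdef.
split => [q x0 q1|//|]; first exact: q_fin.
apply/fam_cvgP => K Kc P /uniform_nbhs[E [entE EP]].
move: entE; rewrite -entourage_ballE => -[e /= e0 eE].
have [B [B0 KB]] : exists B : R, 0 <= B /\ forall x, K x -> `|x| <= B.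
  have [B [_ KB]] := compact_bounded Kc.
  exists (`|B| + 1); split; first by rewrite addr_ge0.
  by move=> x; apply: (KB (`|B| + 1)); have := ler_norm B; lra.
(* The upper estimate loses [e / 3] plus [T / q], the latter below [e / 3] for large [q]; the lower
   one loses [e / 3]. Both stay strictly below [e]. *)
have e30 : 0 < e / 3 by lra.
have [T [T0 upper]] := value_q_upper hn F_cont F_convex F_posdef B0 e30.
have [Q lower] := value_q_lower hn F_cont F_convex F_posdef B0 e30.
near=> q; apply: EP => x Kx; apply: eE => /=.
have q1 : 1 < q by near: q; apply: nbhs_pinfty_gt; exact: num_real.
have Qq : Q < q by near: q; apply: nbhs_pinfty_gt; exact: num_real.
have Tq : T / (e / 3) < q by near: q; apply: nbhs_pinfty_gt; exact: num_real.
have q0 : 0 < q by lra.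
have Tqe : T / q < e / 3.
  by move: Tq; rewrite ltr_pdivrMr// => Tq; rewrite ltr_pdivrMr// mulrC.
have := upper q x q1 (KB x Kx); have := lower q x Qq q1 (KB x Kx).
rewrite -(fineK (lim_fin x)) -(fineK (q_fin q x q1)) -!EFinD !lee_fin => lo up.
rewrite /ball /= ltr_norml; lra.
Unshelve. all: by end_near. Qed.
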